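(* Let $u^n\in\mathcal{C}_h$ satisfy $0<u^n_{i,j}<1$ for all $i,j$, let $\tau>0$, $\rho>0$, and let the multiplier step size satisfy $\alpha\in\left(0,\frac{\sqrt5+1}{2}\right)$. Let $(u_1^{(k)},u_2^{(k)},u_3^{(k)})_{k\ge 0}$ be the sequence generated by the ADMM iteration described in the context. Then the iteration converges: $$\lim_{k\to+\infty}u_1^{(k)}=\lim_{k\to+\infty}u_2^{(k)}=u^{n+1},$$ where $u^{n+1}\in\mathcal{C}_h$ is the unique solution, with values in $(0,1)$, of $$\frac{u^{n+1}-u^n}{\tau}-\epsilon^2\Delta_h u^{n+1}+\log(u^{n+1})-\log(1-u^{n+1})+\theta(1-2u^n)=0 .$$
   Context: Fix $L>0$, a positive integer $N$, $h=L/N$, and parameters $\epsilon>0$, $\theta>2$. $\mathcal{C}_h$ is the real vector space of doubly $N$-periodic grid functions $\phi=(\phi_{i,j})_{i,j\in\mathbb{Z}}$, $\phi_{i,j}=\phi_{i+\lambda N,j+\mu N}$ for all $i,j,\lambda,\mu\in\mathbb{Z}$, with inner product $\langle\phi,\psi\rangle_h=h^2\sum_{i,j=1}^N\phi_{i,j}\psi_{i,j}$ and norm $\|\phi\|_h=\sqrt{\langle\phi,\phi\rangle_h}$. The discrete Laplacian is $(\Delta_h\phi)_{i,j}=\frac1{h^2}(\phi_{i+1,j}+\phi_{i-1,j}+\phi_{i,j+1}+\phi_{i,j-1}-4\phi_{i,j})$. Functions such as $\log$ are applied pointwise, and scalars such as $1$ denote constant grid functions; inequalities are pointwise. ADMM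 iteration: given $u^n$, $\tau,\rho>0$ and $\alpha$, set $u_1^{(0)}=u_2^{(0)}=u^n$, $u_3^{(0)}=0$. For $k=0,1,2,\dots$: (1) $u_2^{(k+1)}\in\mathcal{C}_h$ is the unique grid function with values in $(0,1)$ solving $\log(u_2^{(k+1)})-\log(1-u_2^{(k+1)})+\theta(1-2u^n)-u_3^{(k)}-\rho(u_1^{(k)}-u_2^{(k+1)})=0$; (2) $u_1^{(k+1)}\in\mathcal{C}_h$ is the unique solution of $\left(\frac1\tau-\epsilon^2\Delta_h+\rho\right)u_1^{(k+1)}=\frac1\tau u^n+\rho u_2^{(k+1)}-u_3^{(k)}$; (3) $u_3^{(k+1)}=u_3^{(k)}+\alpha\rho(u_1^{(k+1)}-u_2^{(k+1)})$. *)

(* Defs.v *)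
From HB Require Import structures.
From mathcomp Require Import all_boot all_order all_algebra.
From mathcomp Require Import all_classical all_reals all_analysis.
Import Order.TTheory GRing.Theory Num.Theory.
Import numFieldNormedType.Exports.

Set Implicit Arguments.
Unset Strict Implicit.
Unset Printing Implicit Defensive.

Local Open Scope ring_scope.

(* Grid functions are indexed by all of Z x Z; the space C_h consists of those
   satisfying [grid_periodic N]. *)
Definition grid (R : realType) := int -> int -> R.

Definition grid_periodic (R : realType) (N : nat) (phi : grid R) : Prop :=
  forall i j l m : int, phi i j = phi (i + l * N%:Z) (j + m * N%:Z).

Definition unit_valued (R : realType) (phi : grid R) : Prop :=
  forall i j : int, 0 < phi i j < 1.

Definition inner_h (R : realType) (N : nat) (h : R) (phi psi : grid R) : R :=
  h ^+ 2 * \sum_(1 <= i < N.+1) \sum_(1 <= j < N.+1)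
             phi i%:Z j%:Z * psi i%:Z j%:Z.

Definition norm_h (R : realType) (N : nat) (h : R) (phi : grid R) : R :=
  Num.sqrt (inner_h N h phi phi).

Definition laplacian_h (R : realType) (h : R) (phi : grid R) : grid R :=
  fun i j => (h ^+ 2)^-1 *
    (phi (i + 1) j + phi (i - 1) j + phi i (j + 1) + phi i (j - 1)
     - 4 * phi i j).

Definition cvg_h (R : realType) (N : nat) (h : R) (u : nat -> grid R)
    (v : grid R) : Prop :=
  (norm_h N h (fun i j => u k i j - v i j) @[k --> \oo] --> (0 : R))%classic.

(* [ln] is total and vanishes on nonpositive reals, so the constraint
   [unit_valued] on the unknown is essential in the two equations below. *)
Definition scheme_solution (R : realType) (N : nat) (h eps theta tau : R)
    (un v : grid R) : Prop :=
  [/\ grid_periodic N v, unit_valued v &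
      forall i j : int,
        (v i j - un i j) / tau - eps ^+ 2 * laplacian_h h v i j
        + ln (v i j) - ln (1 - v i j) + theta * (1 - 2 * un i j) = 0].

Definition u2_step (R : realType) (N : nat) (theta rho : R)
    (un u1 u3 v : grid R) : Prop :=
  [/\ grid_periodic N v, unit_valued v &
      forall i j : int,
        ln (v i j) - ln (1 - v i j) + theta * (1 - 2 * un i j)
        - u3 i j - rho * (u1 i j - v i j) = 0].

Definition u1_step (R : realType) (N : nat) (h eps tau rho : R)
    (un u2 u3 v : grid R) : Prop :=
  grid_periodic N v /\
  forall i j : int,
    tau^-1 * v i j - eps ^+ 2 * laplacian_h h v i j + rho * v i j
    = tau^-1 * un i j + rho * u2 i j - u3 i j.

Record iterate (R : realType) :=
  Iterate { u1 : grid R; u2 : grid R; u3 : grid R }.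

Definition admm_next (R : realType) (N : nat)
    (h eps theta tau rho alpha : R) (un : grid R) (s t : iterate R) : Prop :=
  [/\ u2_step N theta rho un (u1 s) (u3 s) (u2 t),
      u1_step N h eps tau rho un (u2 t) (u3 s) (u1 t) &
      forall i j : int,
        u3 t i j = u3 s i j + alpha * rho * (u1 t i j - u2 t i j)].

Definition admm_sequence (R : realType) (N : nat)
    (h eps theta tau rho alpha : R) (un : grid R) (s : nat -> iterate R)
    : Prop :=
  s 0%N = Iterate un un (fun _ _ => 0) /\
  forall k : nat, admm_next N h eps theta tau rho alpha un (s k) (s k.+1).

(* Main.v *)
Require Import Defs.
From HB Require Import structures.
From mathcomp Require Import all_boot all_order all_algebra.
From mathcomp Require Import all_classical all_reals all_analysis.
From mathcomp Require Import ring lra.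
Import Order.TTheory GRing.Theory Num.Theory.
Import numFieldNormedType.Exports.

Local Open Scope ring_scope.

(** Well-posedness.  Every problem to be solved here - the nonlinear step for
    [u2], the linear step for [u1], and the limit scheme itself - has the form
    [b v + g v = f + c * neighbour_sum v] with [g] nondecreasing and [4 c < b].
    Solving for [v i j] with the neighbours given is a [1/b]-Lipschitz
    operation, and the neighbours enter with total weight [4 c], so the
    pointwise solution map contracts the sup norm by [4 c / b < 1] and has
    exactly one periodic fixed point ([monotone_grid_equation]).  The
    singularity of the logarithms at 0 and 1 costs nothing, because
    [b t + logit t] maps (0, 1) onto the whole line ([logit_surjective]).

    Convergence.  Let [x], [y], [lam] be the errors of [u2], [u1], [u3] with
    respect to the saddle point [(v, v, logit v + theta (1 - 2 un))], let
    [A = 1/tau - eps^2 Delta_h], [r = y - x], and let a prime denote the next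
    iterate.  The steps say that [gam' = lam + rho (y - x')] and
    [A y' = - lam - rho r'], where [gam'] is the increment of logit
    corresponding to [x'], while [lam' = lam + alpha rho r'].  Pairing these
    with [x'] and [y'] bounds the decrease of
    [lam^2 / (2 alpha rho) + rho y^2 / 2] from below, except for a cross term
    [rho r' (y' - y)] of no sign.  Subtracting two consecutive [u1] steps
    expresses it through [(1 - alpha) rho r (y' - y) - A (y' - y) (y' - y)];
    completing the square absorbs the first part at the price of adding
    [rho (1 - alpha)^2 r^2 / 2] to the energy.  What remains of the
    dissipation in [r'] is [rho (2 - alpha - (1 - alpha)^2) / 2], and
    [1 + alpha - alpha^2 > 0] on the given range of [alpha]: this is where the
    golden ratio comes from.  All of this is one pointwise identity
    ([admm_energy_identity]); only the sign of the terms containing [A] needs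
    summation over the grid ([implicit_op_coercive]).  The nonnegative energy
    decreases by at least a multiple of the sums of [y'^2] and [r'^2], so both
    tend to 0. *)

(** * The logit function on (0, 1) *)

Definition logit {R : realType} (t : R) : R := ln t - ln (1 - t).

Lemma logit_nondecreasing (R : realType) (s t : R) :
  0 < s < 1 -> 0 < t < 1 -> s <= t -> logit s <= logit t.
Proof.
move=> /andP[s0 s1] /andP[t0 t1] st; rewrite /logit lerB// ler_ln// ?posrE; lra.
Qed.

(** Substituting the logistic function [t = sigma y] turns the equation into
    [y + b * sigma y = x], whose left side is continuous on the whole line
    and, since [sigma] takes values in (0, 1), passes the value [x] between
    [x - b] and [x]. *)
Lemma logit_surjective (R : realType) (b x : R) : 0 <= b ->
  exists2 t : R, 0 < t < 1 & b * t + logit t = x.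
Proof.
move=> b0.
pose sigma (y : R) := (1 + expR y)^-1 * expR y.
have den y : 0 < 1 + expR y by rewrite addr_gt0// expR_gt0.
have sigma01 y : 0 < sigma y < 1.
  rewrite /sigma mulr_gt0 ?invr_gt0 ?expR_gt0//= mulrC ltr_pdivrMr//; lra.
have sigmaC y : 1 - sigma y = (1 + expR y)^-1.
  by rewrite /sigma; field; rewrite gt_eqF.
have logitK y : logit (sigma y) = y.
  rewrite /logit sigmaC lnM ?posrE ?invr_gt0 ?expR_gt0// expRK.
  by rewrite addrC addKr.
have cont : continuous (fun y => y + b * sigma y).
  move=> y; apply: cvgD; first exact: cvg_id.
  apply: cvgM; first exact: cvg_cst.
  apply: cvgM; last exact: continuous_expR.
  apply: cvgV; first by rewrite gt_eqF.
  by apply: cvgD; [exact: cvg_cst|exact: continuous_expR].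
have xb : x - b <= x by lra.
have [|y _ yx] := @IVT R (fun y => y + b * sigma y) _ _ x xb
    (continuous_subspaceT cont).
  have := sigma01 (x - b); have := sigma01 x => /andP[p _] /andP[_ q].
  by rewrite ge_min le_max; apply/andP; split; apply/orP; [left|right]; nra.
by exists (sigma y); rewrite ?logitK// addrC.
Qed.

(** * Periodic grid functions and the fixed point argument *)

Lemma grid_periodic_bounded (R : realType) (N : nat) (phi : grid R) :
  (0 < N)%N -> grid_periodic N phi ->
  exists2 M : R, 0 <= M & forall i j, `|phi i j| <= M.
Proof.
move=> N0 per.
exists (\sum_(p : 'I_N * 'I_N) `|phi (p.1 : nat)%:Z (p.2 : nat)%:Z|).
  by apply: sumr_ge0.
have modN (i : int) : exists (a : 'I_N) (l : int), i = a%:Z + l * N%:Z.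
  (* The representatives of the residue classes are here 0, ..., N - 1. *)
  have Nz : N%:Z != 0 by rewrite eqz_nat -lt0n.
  have := modz_ge0 i Nz; have := @ltz_pmod i N%:Z N0.
  case: (modz i N) (divz_eq i N) => // a eqi aN _.
  by exists (Ordinal aN), (divz i N); rewrite addrC.
move=> i j; have [a [l ->]] := modN i; have [b [m ->]] := modN j.
rewrite -per (bigD1 (a, b))//= lerDl; exact: sumr_ge0.
Qed.

Definition neighbour_sum {R : realType} (phi : grid R) : grid R :=
  fun i j => phi (i + 1) j + phi (i - 1) j + phi i (j + 1) + phi i (j - 1).

Lemma laplacian_neighbour_sum (R : realType) (h : R) (phi : grid R) i j :
  laplacian_h h phi i j = (h ^+ 2)^-1 * (neighbour_sum phi i j - 4 * phi i j).
Proof. by []. Qed.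

Lemma neighbour_sum_periodic (R : realType) (N : nat) (phi : grid R) :
  grid_periodic N phi -> grid_periodic N (neighbour_sum phi).
Proof.
move=> per i j l m; rewrite /neighbour_sum !(addrAC _ (_ * _)).
by congr (_ + _ + _ + _); apply: per.
Qed.

Lemma neighbour_sum_dist (R : realType) (phi psi : grid R) (M : R) :
  (forall i j, `|phi i j - psi i j| <= M) ->
  forall i j, `|neighbour_sum phi i j - neighbour_sum psi i j| <= 4 * M.
Proof.
move=> dM i j; rewrite /neighbour_sum.
move: (dM (i + 1) j) (dM (i - 1) j) (dM i (j + 1)) (dM i (j - 1)).
rewrite !ler_norml => /andP[? ?] /andP[? ?] /andP[? ?] /andP[? ?].
by apply/andP; split; lra.
Qed.

Lemma geometric_increments_cvg (R : realType) (w : nat -> R) (M r : R) :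
  0 <= M -> 0 <= r < 1 -> (forall k, `|w k.+1 - w k| <= M * r ^+ k) -> cvgn w.
Proof.
move=> M0 /andP[r0 r1] wM.
have wE : w = (cst (w 0%N) + series (telescope w))%R.
  by apply/funext => n; rewrite {1}(eq_sum_telescope w n).
rewrite wE; apply: is_cvgD; first exact: is_cvg_cst.
apply: normed_cvg.
apply: (@series_le_cvg _ (fun k => `|telescope w k|) (geometric M r)).
- by move=> n.
- by move=> n; rewrite mulr_ge0// exprn_ge0.
- by move=> n; exact: wM.
- by apply: is_cvg_geometric_series; rewrite ger0_norm.
Qed.

Lemma geometric_bound_eq0 (R : realType) (x M r : R) :
  0 <= r < 1 -> (forall k : nat, `|x| <= M * r ^+ k) -> x = 0.
Proof.
move=> /andP[r0 r1] xM; apply/eqP; rewrite -normr_le0.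
have r1' : `|r| < 1 by rewrite ger0_norm.
have lim0 : (M * r ^+ k @[k --> \oo] --> M * 0)%classic.
  by apply: cvgM; [exact: cvg_cst|exact: cvg_expr].
rewrite mulr0 in lim0.
by rewrite -(cvg_lim _ lim0)//; apply: limr_ge; [exact: cvgP lim0|near=> k].
Unshelve. all: by end_near.
Qed.

(** The resolvent of a monotone map is [1/b]-Lipschitz: [gs] and [gt] stand for
    the values of the map at [s] and [t], and the two differences [b (s - t)]
    and [gs - gt] cannot cancel because they have the same sign. *)
Lemma monotone_perturbation_dist (R : realType) (b s t gs gt : R) : 0 < b ->
  0 <= (gs - gt) * (s - t) ->
  `|s - t| <= b^-1 * `|(b * s + gs) - (b * t + gt)|.
Proof.
move=> b0 mono; rewrite -(ler_pM2l b0) mulrA divff ?gt_eqF// mul1r.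
have -> : b * s + gs - (b * t + gt) = b * (s - t) + (gs - gt) by ring.
rewrite -{1}(gtr0_norm b0) -normrM -ler_sqr ?nnegrE//.
rewrite !real_normK ?num_real//.
by have := mulr_ge0 (ltW b0) mono; have := sqr_ge0 (gs - gt); nra.
Qed.

(** The pointwise solution map [J] is a contraction of ratio [r = 4 c / b]
    in the sup norm; periodic functions are bounded, so Picard iteration from 0
    converges and two fixed points must agree.  The domain [D] is (0, 1) for the
    two logarithmic equations and the whole line for the linear one. *)
Lemma monotone_grid_equation (R : realType) (N : nat) (D : R -> Prop)
    (g : R -> R) (b c : R) (f : grid R) :
  (0 < N)%N -> 0 <= c -> 4 * c < b ->
  (forall s t, D s -> D t -> s <= t -> g s <= g t) ->
  (forall x, exists2 t, D t & b * t + g t = x) ->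
  grid_periodic N f ->
  exists! v : grid R, [/\ grid_periodic N v, forall i j, D (v i j) &
    forall i j, b * v i j + g (v i j) = f i j + c * neighbour_sum v i j].
Proof.
move=> N0 c0 cb gmono gsurj fper.
have b0 : 0 < b by lra.
have dist s t : D s -> D t ->
    `|s - t| <= b^-1 * `|(b * s + g s) - (b * t + g t)|.
  move=> Ds Dt; apply: monotone_perturbation_dist => //.
  have [st|/ltW st] := lerP s t.
    by have := gmono _ _ Ds Dt st; nra.
  by have := gmono _ _ Dt Ds st; nra.
pose r := b^-1 * (c * 4).
have r01 : 0 <= r < 1.
  rewrite /r; apply/andP; split; first by rewrite !mulr_ge0// invr_ge0 ltW.
  by rewrite mulrC ltr_pdivrMr//; lra.
have [r0 r1] := andP r01.
(* T solves the equation at a single point, the neighbours being given. *)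
have [T TD TE] : exists2 T : R -> R, forall x, D (T x) &
    forall x, b * T x + g (T x) = x.
  have /choice[T TP] : forall x, exists t, D t /\ b * t + g t = x.
    by move=> x; have [t] := gsurj x; exists t.
  by exists T => x; have [] := TP x.
have Tdist x y : `|T x - T y| <= b^-1 * `|x - y|.
  by have := dist _ _ (TD x) (TD y); rewrite !TE.
pose J (w : grid R) : grid R := fun i j => T (f i j + c * neighbour_sum w i j).
have Jper w : grid_periodic N w -> grid_periodic N (J w).
  by move=> wper i j l m; rewrite /J -fper -neighbour_sum_periodic.
have contr (w w' : grid R) M : (forall i j, `|w i j - w' i j| <= M) ->
    forall i j, `|J w i j - J w' i j| <= M * r.
  move=> wM i j; apply: (le_trans (Tdist _ _)).
  rewrite (_ : M * r = b^-1 * (c * (4 * M))); last by rewrite /r; ring.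
  rewrite ler_pM2l ?invr_gt0//.
  rewrite (_ : _ - _ = c * (neighbour_sum w i j - neighbour_sum w' i j));
    last by ring.
  by rewrite normrM (ger0_norm c0) ler_wpM2l// neighbour_sum_dist.
have Juniq (v v' : grid R) : grid_periodic N v -> grid_periodic N v' ->
    (forall i j, v i j = J v i j) -> (forall i j, v' i j = J v' i j) -> v = v'.
  move=> vper vper' vE vE'.
  have [|M M0 dM] :=
    @grid_periodic_bounded R N (fun i j => v i j - v' i j) N0.
    by move=> i j l m; rewrite -vper -vper'.
  have dMr k : forall i j, `|v i j - v' i j| <= M * r ^+ k.
    elim: k => [|k IH] i j; first by rewrite expr0 mulr1.
    by rewrite exprSr mulrA vE vE'; exact: contr.
  apply/funext => i; apply/funext => j; apply/eqP; rewrite -subr_eq0; apply/eqP.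
  by apply: (geometric_bound_eq0 _ _ M r) => // k.
pose w k := iter k J (fun _ _ => 0).
have wper k : grid_periodic N (w k).
  by elim: k => [|k IH]; [move=> ? ? ? ?|exact: Jper].
have [|M M0 dM] :=
  @grid_periodic_bounded R N (fun i j => w 1%N i j - w 0%N i j) N0.
  by move=> i j l m; rewrite -(wper 1%N) -(wper 0%N).
have winc k : forall i j, `|w k.+1 i j - w k i j| <= M * r ^+ k.
  elim: k => [|k IH] i j; first by rewrite expr0 mulr1.
  by rewrite exprSr mulrA; exact: contr.
have wcvg i j : cvgn (fun k => w k i j).
  by apply: (geometric_increments_cvg _ _ M r) => // k.
pose v : grid R := fun i j => limn (fun k => w k i j).
have wlim i j : (w k i j @[k --> \oo] --> v i j)%classic by exact: wcvg.
have vper : grid_periodic N v.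
  move=> i j l m; rewrite /v; congr (limn _); apply/funext => k; exact: wper.
have vE i j : v i j = J v i j.
  have nbcvg : (neighbour_sum (w k) i j @[k --> \oo]
      --> neighbour_sum v i j)%classic.
    rewrite /neighbour_sum; apply: cvgD; last exact: wlim.
    by apply: cvgD; [apply: cvgD|]; exact: wlim.
  have Tcont : continuous T.
    move=> x; apply/cvgrPdist_lt => e e0; near=> y.
    apply: (le_lt_trans (Tdist _ _)); rewrite mulrC ltr_pdivrMr//.
    near: y; apply/nbhs_ballP; exists (e * b) => //=; exact: mulr_gt0.
  have Jcvg : (w k.+1 i j @[k --> \oo] --> J v i j)%classic.
    change (T (f i j + c * neighbour_sum (w k) i j) @[k --> \oo]
      --> T (f i j + c * neighbour_sum v i j))%classic.
    apply: continuous_cvg; first exact: Tcont.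
    apply: cvgD; first exact: cvg_cst.
    by apply: cvgM => //; exact: cvg_cst.
  have := wlim i j; rewrite -(cvg_shiftS (fun k => w k i j)) => vcvg.
  exact: cvg_unique vcvg Jcvg.
exists v; split.
  by split => // i j; rewrite vE /J ?TE.
move=> v' [v'per v'D v'E]; apply: Juniq => // i j.
(* A solution has the same image as [T] under [b t + g t], hence equals it. *)
have := dist _ _ (v'D i j) (TD (f i j + c * neighbour_sum v' i j)).
rewrite v'E TE subrr normr0 mulr0 normr_le0 subr_eq0 => /eqP; exact.
Unshelve. all: by end_near.
Qed.

(** * Well-posedness of the steps and of the scheme *)

Lemma u2_step_exists_unique (R : realType) (N : nat) (theta rho : R)
    (un v1 v3 : grid R) :
  (0 < N)%N -> 0 < rho -> grid_periodic N un -> grid_periodic N v1 ->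
  grid_periodic N v3 -> exists! v, u2_step N theta rho un v1 v3 v.
Proof.
move=> N0 rho0 unper per1 per3.
have [|||||v [[vper v01 vE] vuniq]] := @monotone_grid_equation R N
  (fun t => 0 < t < 1) logit rho 0
  (fun i j => v3 i j + rho * v1 i j - theta * (1 - 2 * un i j)) N0.
- exact: lexx.
- lra.
- exact: logit_nondecreasing.
- by move=> x; apply: logit_surjective; exact: ltW.
- by move=> i j l m; rewrite -unper -per1 -per3.
exists v; split.
  split=> // i j; have := vE i j; rewrite /logit; lra.
move=> w [wper w01 wE]; apply: vuniq; split=> // i j.
by have := wE i j; rewrite /logit; lra.
Qed.

Lemma u1_step_exists_unique (R : realType) (N : nat) (h eps tau rho : R)
    (un v2 v3 : grid R) :
  (0 < N)%N -> 0 < tau -> 0 < rho -> grid_periodic N un ->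
  grid_periodic N v2 -> grid_periodic N v3 ->
  exists! v, u1_step N h eps tau rho un v2 v3 v.
Proof.
move=> N0 tau0 rho0 unper per2 per3.
pose c := eps ^+ 2 * (h ^+ 2)^-1.
have c0 : 0 <= c by rewrite mulr_ge0 ?invr_ge0 ?sqr_ge0.
have tauV0 : 0 < tau^-1 by rewrite invr_gt0.
have [|||||v [[vper _ vE] vuniq]] := @monotone_grid_equation R N
  (fun=> True) (fun=> 0) (tau^-1 + rho + 4 * c) c
  (fun i j => tau^-1 * un i j + rho * v2 i j - v3 i j) N0.
- exact: c0.
- lra.
- by [].
- move=> x; exists ((tau^-1 + rho + 4 * c)^-1 * x) => //.
  by rewrite addr0 mulVKf// gt_eqF//; lra.
- by move=> i j l m; rewrite -unper -per2 -per3.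
exists v; split.
  split=> // i j; have := vE i j; rewrite laplacian_neighbour_sum /c; lra.
move=> w [wper wE]; apply: vuniq; split=> // i j.
by have := wE i j; rewrite laplacian_neighbour_sum /c; lra.
Qed.

Lemma scheme_solution_exists_unique (R : realType) (N : nat)
    (h eps theta tau : R) (un : grid R) :
  (0 < N)%N -> 0 < tau -> grid_periodic N un ->
  exists! v, scheme_solution N h eps theta tau un v.
Proof.
move=> N0 tau0 unper.
pose c := eps ^+ 2 * (h ^+ 2)^-1.
have c0 : 0 <= c by rewrite mulr_ge0 ?invr_ge0 ?sqr_ge0.
have tauV0 : 0 < tau^-1 by rewrite invr_gt0.
have [|||||v [[vper v01 vE] vuniq]] := @monotone_grid_equation R N
  (fun t => 0 < t < 1) logit (tau^-1 + 4 * c) c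
  (fun i j => tau^-1 * un i j - theta * (1 - 2 * un i j)) N0.
- exact: c0.
- lra.
- exact: logit_nondecreasing.
- by move=> x; apply: logit_surjective; lra.
- by move=> i j l m; rewrite -unper.
exists v; split.
  split=> // i j; have := vE i j.
  by rewrite laplacian_neighbour_sum /c /logit; lra.
move=> w [wper w01 wE]; apply: vuniq; split=> // i j.
by have := wE i j; rewrite laplacian_neighbour_sum /c /logit; lra.
Qed.

(** Solvability of the steps rests on periodic data, so existence carries the
    periodicity of [u1] and [u3] along the iteration.  Uniqueness must
    recover it: [admm_next] says nothing about the periodicity of [u3], but
    its update formula preserves it. *)
Lemma admm_sequence_exists_unique (R : realType) (N : nat)
    (h eps theta tau rho alpha : R) (un : grid R) :
  (0 < N)%N -> 0 < tau -> 0 < rho -> grid_periodic N un ->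
  exists! s, admm_sequence N h eps theta tau rho alpha un s.
Proof.
move=> N0 tau0 rho0 unper.
pose P (s : iterate R) := grid_periodic N (u1 s) /\ grid_periodic N (u3 s).
have nextP s : P s ->
    exists! t, P t /\ admm_next N h eps theta tau rho alpha un s t.
  move=> [per1 per3].
  have [v2 [v2E v2uniq]] :=
    u2_step_exists_unique R N theta rho un _ _ N0 rho0 unper per1 per3.
  have per2 : grid_periodic N v2 by case: v2E.
  have [v1 [v1E v1uniq]] :=
    u1_step_exists_unique R N h eps tau rho un _ _
      N0 tau0 rho0 unper per2 per3.
  have perv1 : grid_periodic N v1 by case: v1E.
  exists (Iterate v1 v2
    (fun i j => u3 s i j + alpha * rho * (v1 i j - v2 i j))).
  split.
    split=> //; split=> //= i j l m.
    by rewrite -per3 -per2 -perv1.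
  move=> [w1 w2 w3] [_ [/= /v2uniq <- /v1uniq <- w3E]].
  by congr Iterate; apply/funext => i; apply/funext => j; rewrite w3E.
have /choice[nxt nxtP] : forall s, exists t, P s ->
    P t /\ admm_next N h eps theta tau rho alpha un s t.
  move=> s; have [/nextP[t [tP _]]|nPs] := pselect (P s); first by exists t.
  by exists s.
have P0 : P (Iterate un un (fun _ _ => 0)) by split.
pose s k := iter k nxt (Iterate un un (fun _ _ => 0)).
have sP k : P (s k) by elim: k => // k IH; exact: (nxtP _ IH).1.
exists s; split.
  by split=> // k; exact: (nxtP _ (sP k)).2.
move=> s' [s'0 s'next]; apply/funext; elim=> [|k IH]; first by rewrite s'0.
have [t [_ tuniq]] := nextP _ (sP k).
have ts : t = s k.+1 by apply: tuniq; exact: nxtP.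
rewrite -ts; apply: tuniq; have := s'next k; rewrite -IH => tE; split=> //.
have [[per2 _ _] [per1 _] E3] := tE; have [_ per3] := sP k.
by split=> // i j l m; rewrite !E3 -per3 -per1 -per2.
Qed.

(** * Sums over a period and the sign of the discrete Laplacian *)

Definition grid_sum {R : realType} (N : nat) (phi : grid R) : R :=
  \sum_(1 <= i < N.+1) \sum_(1 <= j < N.+1) phi i%:Z j%:Z.

Lemma eq_grid_sum (R : realType) (N : nat) (phi psi : grid R) :
  (forall i j, phi i j = psi i j) -> grid_sum N phi = grid_sum N psi.
Proof. by move=> e; apply: eq_bigr => i _; apply: eq_bigr => j _. Qed.

Lemma grid_sumD (R : realType) (N : nat) (phi psi : grid R) :
  grid_sum N (fun i j => phi i j + psi i j) = grid_sum N phi + grid_sum N psi.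
Proof. by rewrite -big_split; apply: eq_bigr => i _; rewrite big_split. Qed.

Lemma grid_sumZ (R : realType) (N : nat) (a : R) (phi : grid R) :
  grid_sum N (fun i j => a * phi i j) = a * grid_sum N phi.
Proof. by rewrite mulr_sumr; apply: eq_bigr => i _; rewrite mulr_sumr. Qed.

Lemma ler_grid_sum (R : realType) (N : nat) (phi psi : grid R) :
  (forall i j, phi i j <= psi i j) -> grid_sum N phi <= grid_sum N psi.
Proof. by move=> le; apply: ler_sum => i _; apply: ler_sum => j _. Qed.

Lemma grid_sum_ge0 (R : realType) (N : nat) (phi : grid R) :
  (forall i j, 0 <= phi i j) -> 0 <= grid_sum N phi.
Proof. by move=> ge0; apply: sumr_ge0 => i _; apply: sumr_ge0 => j _. Qed.

(** Adding [p 1] on the left and [p (1 + N)] on the right makes both sides the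
    sum of [p] over 1, ..., N + 1. *)
Lemma periodic_sum_shift (R : realType) (N : nat) (p : int -> R) :
  p (1 + N%:Z) = p 1 ->
  \sum_(1 <= i < N.+1) p (i%:Z + 1) = \sum_(1 <= i < N.+1) p i%:Z.
Proof.
move=> per; apply: (addrI (p 1)).
rewrite [RHS]addrC -{2}per -[1 + N%:Z]/(N.+1)%:Z.
rewrite -(@big_nat_recr _ _ _ N.+1 1 (fun i => p i%:Z))//=.
rewrite [RHS]big_ltn//; congr (_ + _).
by rewrite [RHS]big_add1; apply: eq_bigr => i _; rewrite -addn1 PoszD.
Qed.

Lemma grid_sum_shift1 (R : realType) (N : nat) (phi : grid R) :
  grid_periodic N phi -> grid_sum N (fun i j => phi (i + 1) j) = grid_sum N phi.
Proof.
move=> per; rewrite /grid_sum.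
apply: (periodic_sum_shift R N (fun i => \sum_(1 <= j < N.+1) phi i j%:Z)).
by apply: eq_bigr => j _; rewrite (per 1 j 1 0) mul1r mul0r addr0.
Qed.

Lemma grid_sum_shift2 (R : realType) (N : nat) (phi : grid R) :
  grid_periodic N phi -> grid_sum N (fun i j => phi i (j + 1)) = grid_sum N phi.
Proof.
move=> per; apply: eq_bigr => i _; apply: periodic_sum_shift.
by rewrite (per i 1 0 1) mul1r mul0r addr0.
Qed.

Lemma grid_sum_neighbour_sum (R : realType) (N : nat) (phi : grid R) :
  grid_periodic N phi -> grid_sum N (neighbour_sum phi) = 4 * grid_sum N phi.
Proof.
move=> per.
have back1 : grid_sum N (fun i j => phi (i - 1) j) = grid_sum N phi.
  rewrite -[LHS]grid_sum_shift1; last first.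
    by move=> i j l m; rewrite (per _ _ l m) addrAC.
  by apply: eq_grid_sum => i j; rewrite addrK.
have back2 : grid_sum N (fun i j => phi i (j - 1)) = grid_sum N phi.
  rewrite -[LHS]grid_sum_shift2; last first.
    by move=> i j l m; rewrite (per _ _ l m) addrAC.
  by apply: eq_grid_sum => i j; rewrite addrK.
rewrite /neighbour_sum !grid_sumD back1 back2 grid_sum_shift1//.
by rewrite grid_sum_shift2//; ring.
Qed.

(** Young's inequality [a p <= (a^2 + p^2) / 2] for each of the four neighbours
    [a] of a point with value [p] bounds [Delta_h phi * phi] by half of
    [Delta_h (phi^2)], whose sum over a period vanishes. *)
Lemma grid_sum_laplacian_le0 (R : realType) (N : nat) (h : R) (phi : grid R) :
  grid_periodic N phi ->
  grid_sum N (fun i j => laplacian_h h phi i j * phi i j) <= 0.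
Proof.
move=> per; pose sq : grid R := fun i j => phi i j ^+ 2.
have sqper : grid_periodic N sq by move=> i j l m; rewrite /sq -per.
have hV : 0 <= (h ^+ 2)^-1 by rewrite invr_ge0 sqr_ge0.
apply: (@le_trans _ _ (grid_sum N
    (fun i j =>
      (h ^+ 2)^-1 * (2^-1 * (neighbour_sum sq i j + (- 4) * sq i j))))).
  apply: ler_grid_sum => i j.
  rewrite laplacian_neighbour_sum -mulrA ler_wpM2l//.
  rewrite /neighbour_sum /sq.
  set p := phi i j; set a := phi (i + 1) j; set b := phi (i - 1) j.
  set c := phi i (j + 1); set d := phi i (j - 1).
  have := sqr_ge0 (a - p); have := sqr_ge0 (b - p).
  by have := sqr_ge0 (c - p); have := sqr_ge0 (d - p); nra.
rewrite !grid_sumZ grid_sumD grid_sumZ grid_sum_neighbour_sum//.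
by rewrite mulNr subrr !mulr0.
Qed.

(** * Energy dissipation of the iteration *)

Lemma logit_monotone (R : realType) (s t : R) :
  0 < s < 1 -> 0 < t < 1 -> 0 <= (logit s - logit t) * (s - t).
Proof.
move=> s01 t01; have [st|/ltW ts] := lerP s t.
  by have := logit_nondecreasing R _ _ s01 t01 st; nra.
by have := logit_nondecreasing R _ _ t01 s01 ts; nra.
Qed.

Lemma dissipation_cvg0 (R : realType) (E D : nat -> R) :
  (forall k, 0 <= E k) -> (forall k, 0 <= D k) ->
  (forall k, D k <= E k - E k.+1) -> (D k @[k --> \oo] --> (0 : R))%classic.
Proof.
move=> E0 D0 DE.
have Ecvg : cvgn E.
  apply: nonincreasing_is_cvgn.
    by apply/nonincreasing_seqP => n; have := D0 n; have := DE n; lra.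
  by exists 0 => _ [k _ <-].
have diff : (E k - E k.+1 @[k --> \oo] --> limn E - limn E)%classic.
  by apply: cvgB; [|rewrite (cvg_shiftS E)]; exact: Ecvg.
rewrite subrr in diff; apply: (squeeze_cvgr _ (cvg_cst 0) diff).
by apply: nearW => k; rewrite D0 DE.
Qed.

(** The shift [m] is there because the dissipation estimate controls only the
    iterates from index 2 on. *)
Lemma cvg_h_bounded_by (R : realType) (N : nat) (h C : R) (u : nat -> grid R)
    (v : grid R) (D : nat -> R) (m : nat) :
  (D k @[k --> \oo] --> (0 : R))%classic ->
  (forall k,
    grid_sum N (fun i j => (u (k + m)%N i j - v i j) ^+ 2) <= C * D k) ->
  cvg_h N h u v.
Proof.
move=> Dcvg uD; rewrite /cvg_h -(cvg_shiftn m) /=.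
have arg : (h ^+ 2 * (C * D k) @[k --> \oo] --> (0 : R))%classic.
  rewrite (_ : 0 = h ^+ 2 * (C * 0)); last by rewrite !mulr0.
  by apply: cvgM; [exact: cvg_cst|apply: cvgM; [exact: cvg_cst|]].
have := cvg_comp _ _ arg (@sqrt_continuous R 0); rewrite sqrtr0 => up.
apply: (squeeze_cvgr _ (cvg_cst 0) up); apply: nearW => k.
rewrite sqrtr_ge0 /=; apply: ler_wsqrtr; apply: ler_wpM2l; first exact: sqr_ge0.
apply: le_trans (uD k); rewrite /grid_sum.
by do 2!apply: ler_sum => ? _; rewrite expr2.
Qed.

(** The usual Lyapunov function of the method with multiplier step [alpha],
    plus a last term that compensates for the cross term left over when
    [alpha] differs from 1. *)
Definition admm_energy {R : realType} (rho alpha x y lam : R) : R :=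
  lam ^+ 2 / (2 * (alpha * rho)) + rho / 2 * y ^+ 2
  + rho / 2 * (1 - alpha) ^+ 2 * (y - x) ^+ 2.

(** The index 0, 1 numbers two consecutive iterates, but [lam0], [lam1] are the
    multipliers that enter their computation, so the energies pair [x0], [y0]
    with [lam1] and [x1], [y1] with [lam2].  Both steps for [y] are
    used, through [q0] and [q1]; hence the identity does not apply to the step
    that starts from the initial data. *)
Lemma admm_energy_identity (R : realType)
    (rho alpha x0 y0 x1 y1 lam0 lam1 lam2 gam q0 q1 : R) :
  rho != 0 -> alpha != 0 ->
  lam1 = lam0 + alpha * rho * (y0 - x0) ->
  lam2 = lam1 + alpha * rho * (y1 - x1) ->
  gam = lam1 + rho * (y0 - x1) ->
  q0 = - lam0 - rho * (y0 - x0) ->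
  q1 = - lam1 - rho * (y1 - x1) ->
  admm_energy rho alpha x0 y0 lam1 - admm_energy rho alpha x1 y1 lam2 =
    gam * x1 + q1 * y1 + (q1 - q0) * (y1 - y0)
    + rho / 2 * (1 + alpha - alpha ^+ 2) * (y1 - x1) ^+ 2
    + rho / 2 * ((1 - alpha) * (y0 - x0) - (y1 - y0)) ^+ 2.
Proof.
move=> rho0 alpha0 -> -> -> -> ->; rewrite /admm_energy.
by field; rewrite rho0 alpha0.
Qed.

(** The golden ratio is the positive root of [1 + alpha - alpha^2]. *)
Lemma golden_ratio_gap (R : realType) (alpha : R) :
  0 < alpha -> alpha < (Num.sqrt 5 + 1) / 2 -> 0 < 1 + alpha - alpha ^+ 2.
Proof.
move=> a0 a1; have s0 := @sqrtr_ge0 R 5.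
have s5 : Num.sqrt 5 ^+ 2 = 5 :> R by rewrite sqr_sqrtr.
move: a1 s0 s5; set q : R := Num.sqrt 5 => a1 s0 s5.
by have [?|?] := lerP alpha (1 / 2); nra.
Qed.

(** The operator [1/tau - eps^2 Delta_h] of the implicit linear part. *)
Definition implicit_op {R : realType} (h eps tau : R) (phi : grid R) : grid R :=
  fun i j => tau^-1 * phi i j - eps ^+ 2 * laplacian_h h phi i j.

Lemma implicit_opB (R : realType) (h eps tau : R) (phi psi : grid R) i j :
  implicit_op h eps tau (fun i j => phi i j - psi i j) i j =
  implicit_op h eps tau phi i j - implicit_op h eps tau psi i j.
Proof. by rewrite /implicit_op /laplacian_h; ring. Qed.

Lemma implicit_op_coercive (R : realType) (N : nat) (h eps tau : R)
    (phi : grid R) :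
  grid_periodic N phi ->
  tau^-1 * grid_sum N (fun i j => phi i j ^+ 2) <=
  grid_sum N (fun i j => implicit_op h eps tau phi i j * phi i j).
Proof.
move=> per; have lap := grid_sum_laplacian_le0 R N h phi per.
rewrite [leRHS](eq_grid_sum R N _ (fun i j => tau^-1 * phi i j ^+ 2
    + - eps ^+ 2 * (laplacian_h h phi i j * phi i j))); last first.
  by move=> i j; rewrite /implicit_op; ring.
rewrite grid_sumD !grid_sumZ lerDl mulr_le0 ?oppr_le0 ?sqr_ge0//.
Qed.

(** Summing [admm_energy_identity] over a period, its first three terms are
    nonnegative because logit is monotone and [implicit_op] is coercive; the
    coercivity also yields the control of [y] itself. *)
Lemma admm_sequence_cvg (R : realType) (N : nat)
    (h eps theta tau rho alpha : R) (un : grid R) (s : nat -> iterate R)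
    (v : grid R) :
  0 < tau -> 0 < rho -> 0 < alpha -> 0 < 1 + alpha - alpha ^+ 2 ->
  grid_periodic N un ->
  admm_sequence N h eps theta tau rho alpha un s ->
  scheme_solution N h eps theta tau un v ->
  cvg_h N h (fun k => u1 (s k)) v /\ cvg_h N h (fun k => u2 (s k)) v.
Proof.
move=> tau0 rho0 alpha0 gap0 unper [s0 snext] [vper v01 vE].
have tauV0 : 0 < tau^-1 by rewrite invr_gt0.
pose A := implicit_op h eps tau.
(* [lamv] is the multiplier of the fixed point: it makes both steps for [v]
   equivalent to the scheme. *)
pose lamv : grid R := fun i j => logit (v i j) + theta * (1 - 2 * un i j).
pose x k : grid R := fun i j => u2 (s k) i j - v i j.
pose y k : grid R := fun i j => u1 (s k) i j - v i j.
pose lam k : grid R := fun i j => u3 (s k) i j - lamv i j.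
pose gam k : grid R := fun i j => logit (u2 (s k) i j) - logit (v i j).
have yper k : grid_periodic N (y k).
  have u1per : grid_periodic N (u1 (s k)).
    by case: k => [|k]; [rewrite s0|case: (snext k) => _ []].
  by move=> i j l m; rewrite /y -u1per -vper.
have lamE k i j :
    lam k.+1 i j = lam k i j + alpha * rho * (y k.+1 i j - x k.+1 i j).
  by have [_ _ E3] := snext k; rewrite /lam /y /x E3; ring.
have gamE k i j : gam k.+1 i j = lam k i j + rho * (y k i j - x k.+1 i j).
  have [[_ _ E2] _ _] := snext k; have := E2 i j.
  by rewrite /gam /lam /lamv /y /x /logit; lra.
have AE k i j : A (y k.+1) i j = - lam k i j - rho * (y k.+1 i j - x k.+1 i j).
  have [_ [_ E1] _] := snext k; have := E1 i j; have := vE i j.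
  rewrite /A implicit_opB /implicit_op /lam /lamv /y /x /logit; lra.
have gam_ge0 k i j : 0 <= gam k.+1 i j * x k.+1 i j.
  by have [[_ u01 _] _ _] := snext k; exact: logit_monotone.
pose e k : grid R := fun i j =>
  admm_energy rho alpha (x k i j) (y k i j) (lam k i j).
(* The energy starts at index 1, where the equation of the [u1] step first
   holds. *)
pose E k := grid_sum N (e k.+1).
pose kappa := rho / 2 * (1 + alpha - alpha ^+ 2).
have kappa0 : 0 < kappa by rewrite /kappa mulr_gt0// divr_gt0.
pose Y k := grid_sum N (fun i j => y k.+2 i j ^+ 2).
pose Z k := grid_sum N (fun i j => (y k.+2 i j - x k.+2 i j) ^+ 2).
pose D k := tau^-1 * Y k + kappa * Z k.
have Y0 k : 0 <= Y k by apply: grid_sum_ge0 => i j; exact: sqr_ge0.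
have Z0 k : 0 <= Z k by apply: grid_sum_ge0 => i j; exact: sqr_ge0.
have E0 k : 0 <= E k.
  apply: grid_sum_ge0 => i j; rewrite /e /admm_energy.
  have rho2 : 0 <= rho / 2 by rewrite divr_ge0// ltW.
  have den : 0 <= (2 * (alpha * rho))^-1.
    by rewrite invr_ge0 ltW// !mulr_gt0.
  apply: addr_ge0; first by apply: addr_ge0; apply: mulr_ge0;
    rewrite ?sqr_ge0.
  by apply: mulr_ge0; [apply: mulr_ge0 => //|]; exact: sqr_ge0.
have DE k : D k <= E k - E k.+1.
  pose d : grid R := fun i j => y k.+2 i j - y k.+1 i j.
  have dper : grid_periodic N d by move=> i j l m; rewrite /d -!yper.
  have dd : 0 <= grid_sum N (fun i j => A d i j * d i j).
    apply: le_trans (implicit_op_coercive R N h eps tau d dper).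
    by apply: mulr_ge0; [exact: ltW|apply: grid_sum_ge0 => i j; exact: sqr_ge0].
  have yy := implicit_op_coercive R N h eps tau _ (yper k.+2).
  apply: (@le_trans _ _ (grid_sum N (fun i j => A (y k.+2) i j * y k.+2 i j)
      + grid_sum N (fun i j => A d i j * d i j) + kappa * Z k)).
    by rewrite lerD2r; apply: (le_trans yy); rewrite lerDl.
  rewrite /E lerBrDr /Z -grid_sumZ -!grid_sumD; apply: ler_grid_sum => i j.
  have id := @admm_energy_identity R rho alpha _ _ _ _ _ _ _ _ _ _
    (lt0r_neq0 rho0) (lt0r_neq0 alpha0) (lamE k i j) (lamE k.+1 i j)
    (gamE k.+1 i j) (AE k i j) (AE k.+1 i j).
  have := gam_ge0 k.+1 i j.
  have : 0 <= rho / 2 * ((1 - alpha) * (y k.+1 i j - x k.+1 i j)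
    - (y k.+2 i j - y k.+1 i j)) ^+ 2.
    by rewrite mulr_ge0 ?sqr_ge0// ltW// divr_gt0.
  have Ad : A d i j = A (y k.+2) i j - A (y k.+1) i j by exact: implicit_opB.
  by rewrite -lerBrDr Ad /e id /d /kappa; lra.
have D0 k : 0 <= D k by rewrite addr_ge0// mulr_ge0// ltW.
have Dcvg := dissipation_cvg0 R E D E0 D0 DE.
have YD k : Y k <= tau * D k.
  by rewrite /D mulrDr mulVKf ?gt_eqF// lerDl !mulr_ge0// ltW.
have ZD k : Z k <= kappa^-1 * D k.
  by rewrite /D mulrDr mulKf ?gt_eqF// lerDr !mulr_ge0// ?invr_ge0 ltW.
split.
  by apply: (cvg_h_bounded_by R N h tau _ _ D 2) => // k;
    rewrite addn2; exact: YD.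
apply: (cvg_h_bounded_by R N h (2 * tau + 2 * kappa^-1) _ _ D 2) => // k.
apply: (@le_trans _ _ (2 * Y k + 2 * Z k)); last first.
  by have := YD k; have := ZD k; lra.
(* [x = y - (y - x)], hence [x^2 <= 2 y^2 + 2 (y - x)^2]. *)
rewrite addn2 -!grid_sumZ -grid_sumD; apply: ler_grid_sum => i j.
rewrite -/(x k.+2 i j).
by have := sqr_ge0 (2 * y k.+2 i j - x k.+2 i j); nra.
Qed.

Theorem theorem4p5 (R : realType) (L : R) (N : nat)
    (eps theta tau rho alpha : R) (un : grid R)
    (hL : 0 < L) (hN : (0 < N)%N) (heps : 0 < eps) (htheta : 2 < theta)
    (htau : 0 < tau) (hrho : 0 < rho)
    (halpha0 : 0 < alpha) (halpha1 : alpha < (Num.sqrt 5 + 1) / 2)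
    (hun_per : grid_periodic N un) (hun : unit_valued un) :
  let h := L / N%:R in
  (exists! s : nat -> iterate R,
     admm_sequence N h eps theta tau rho alpha un s) /\
  (exists! v : grid R, scheme_solution N h eps theta tau un v) /\
  (forall (s : nat -> iterate R) (v : grid R),
     admm_sequence N h eps theta tau rho alpha un s ->
     scheme_solution N h eps theta tau un v ->
     cvg_h N h (fun k => u1 (s k)) v /\ cvg_h N h (fun k => u2 (s k)) v).
Proof.
move=> h; split; first exact: admm_sequence_exists_unique.
split; first exact: scheme_solution_exists_unique.
move=> s v; apply: admm_sequence_cvg => //.
exact: golden_ratio_gap.
Qed.
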